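(* Let $(W,\mathcal S)$ be a finite Coxeter system, $\mathsf c$ a Coxeter word and $m\ge 1$. For any two $m$-factorizations $\mathsf w,\mathsf w'$ of $\mathsf c$, there exists at most one $\mathsf c$-increasing saturated chain from $\mathsf w$ to $\mathsf w'$ in $\mathrm{Camb}^{(m)}(W,\mathsf c)$.
   Context: Let $\mathcal R$ be the set of reflections (conjugates of elements of $\mathcal S$), $w_\circ$ the longest element of $W$. A Coxeter word $\mathsf c$ is a word in which each element of $\mathcal S$ appears exactly once; $c\in W$ is its product. Reflection order. The $\mathsf c$-sorting word of $w\in W$ is the leftmost subword of $\mathsf c^\infty=\mathsf c\mathsf c\mathsf c\cdots$ that is a reduced word of $w$. Write the $\mathsf c$-sorting word of $w_\circ$ as $\mathsf s_1\cdots\mathsf s_N$ and put $t_i=s_1\cdots s_{i-1}s_is_{i-1}\cdots s_1$. Each reflection is exactly one of the $t_i$. The reflection order is $t_1<_{\mathsf c}\cdots<_{\mathsf c}t_N$, and $\mathsf R(\mathsf c)=\mathsf t_1\cdots\mathsf t_N$. $m$-factorizations. A colored reflection $r^{(i)}$ ($r\in\mathcal R$, $0\le i\le m$) stands for the letter $r$ in the $(i+1)$-st copy of $\mathsf R(\mathsf c)$ in $\mathsf R(\mathsf c)^{m+1}$. Colored reflections are ordered by $\le_{\mathsf c}$, first by color and then by the reflection order (i.e. by position in $\mathsf R(\mathsf c)^{m+1}$). An $m$-factorization of $\mathsf c$ is a subword of $\mathsf R(\mathsf c)^{m+1}$ that is a reduced $\mathcal R$-word of $c$ (i.e. $|\mathcal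 S|$ letters with product $c$); it is regarded as a set of colored reflections. Increasing rotation. If $\mathsf w$ is an $m$-factorization containing $r^{(i)}$ with $i<m$, the increasing rotation of $\mathsf w$ at the rotated reflection $r^{(i)}$ is the $m$-factorization obtained by replacing $r^{(i)}$ by $r^{(i+1)}$ and replacing every colored reflection $t^{(j)}$ of $\mathsf w$ strictly between $r^{(i)}$ and $r^{(i+1)}$ by the unique colored copy of $rtr$ lying strictly between $r^{(i)}$ and $r^{(i+1)}$; all other letters are kept. The $m$-Cambrian lattice $\mathrm{Camb}^{(m)}(W,\mathsf c)$ is the poset on $m$-factorizations whose order is the reflexive transitive closure of increasing rotations; the covers of $\mathsf w$ are exactly its increasing rotations. A saturated chain $\mathsf w=\mathsf w_0\lessdot\cdots\lessdot\mathsf w_k=\mathsf w'$ of increasing rotations is $\mathsf c$-increasing if its successive rotated (colored) reflections are increasing for $<_{\mathsf c}$. *)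

(* Defs.v *)
From mathcomp Require Import all_boot all_order all_fingroup.

Set Implicit Arguments.
Unset Strict Implicit.
Unset Printing Implicit Defensive.

Local Open Scope group_scope.

(* Bourbaki's definition: S generates W, its elements have order 2, and W has
   the presentation < S | (s t)^(order of s t) = 1 >.  The presentation is
   expressed by its universal property against arbitrary, possibly infinite,
   groups; the extension phi is unique because S generates W. *)
Definition coxeter_system (gT : finGroupType) (W : {group gT})
    (S : {set gT}) : Prop :=
  [/\ <<S>> = W,
      forall s, s \in S -> #[s] = 2
    & forall (H : groupType) (f : gT -> H),
        (forall s t, s \in S -> t \in S -> (f s * f t) ^+ #[s * t] = 1) ->
        exists phi : gT -> H,
          {in W &, {morph phi : x y / x * y}} /\ {in S, phi =1 f}].

Definition reflections (gT : finGroupType) (W : {group gT})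
    (S : {set gT}) : {set gT} := class_support S W.

Definition word_for (gT : finGroupType) (A : {set gT}) (u : gT)
    (w : seq gT) : Prop :=
  {subset w <= A} /\ \prod_(x <- w) x = u.

Definition reduced_word (gT : finGroupType) (A : {set gT}) (u : gT)
    (w : seq gT) : Prop :=
  word_for A u w /\ forall w', word_for A u w' -> size w <= size w'.

Definition longest_element (gT : finGroupType) (W : {group gT})
    (S : {set gT}) (w0 : gT) : Prop :=
  w0 \in W /\
  forall u w w', reduced_word S w0 w -> u \in W -> reduced_word S u w' ->
    size w' <= size w.

Definition coxeter_word (gT : finGroupType) (S : {set gT})
    (c : seq gT) : Prop := perm_eq c (enum S).

(* A subword of the infinite word c c c ... is given by the strictly increasing
   sequence p of its positions, counted from 0. *)
Definition subword_at (gT : finGroupType) (c : seq gT) (p : seq nat) : seq gT :=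
  [seq nth 1 c (k %% size c) | k <- p].

Definition reduced_positions (gT : finGroupType) (S : {set gT}) (c : seq gT)
    (u : gT) (p : seq nat) : Prop :=
  sorted ltn p /\ reduced_word S u (subword_at c p).

(* "Leftmost" means that the sequence of positions is lexicographically
   smallest. *)
Definition sorting_word (gT : finGroupType) (S : {set gT}) (c : seq gT)
    (u : gT) (w : seq gT) : Prop :=
  exists p : seq nat,
    [/\ reduced_positions S c u p,
        forall p', reduced_positions S c u p' ->
          ((p : seqlexi nat) <= (p' : seqlexi nat))%O
      & w = subword_at c p].

Definition reflection_sequence (gT : finGroupType) (w : seq gT) : seq gT :=
  mkseq (fun i => \prod_(x <- take i w) x * nth 1 w i
                  * \prod_(x <- rev (take i w)) x) (size w).

(* Rc is the word R(c), which lists the reflections in the reflection order. *)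
Definition reflection_word (gT : finGroupType) (W : {group gT})
    (S : {set gT}) (c Rc : seq gT) : Prop :=
  exists w0 w, [/\ longest_element W S w0, sorting_word S c w0 w
                 & Rc = reflection_sequence w].

(* The pair (r, i) is the colored reflection r^(i). *)
Notation colored gT m := (gT * 'I_m.+1)%type.

(* The word R(c)^(m+1), each letter being tagged with its color. *)
Definition colored_word (gT : finGroupType) (m : nat) (Rc : seq gT) :
    seq (colored gT m) :=
  [seq (r, i) | i <- enum 'I_m.+1, r <- Rc].

Definition colored_lt (gT : finGroupType) (m : nat) (Rc : seq gT) :
    rel (colored gT m) :=
  fun x y => index x (colored_word m Rc) < index y (colored_word m Rc).

Definition m_factorization (gT : finGroupType) (W : {group gT}) (S : {set gT})
    (c Rc : seq gT) (m : nat) (F : {set colored gT m}) : Prop :=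
  {subset F <= colored_word m Rc} /\
  reduced_word (reflections W S) (\prod_(s <- c) s)
    [seq x.1 | x <- colored_word m Rc & x \in F].

Definition next_color (gT : finGroupType) (m : nat) (x : colored gT m) :
    colored gT m := (x.1, inord x.2.+1).

Definition strictly_between (gT : finGroupType) (m : nat) (Rc : seq gT)
    (x y : colored gT m) : bool :=
  colored_lt Rc x y && colored_lt Rc y (next_color x).

(* What the letter y becomes in the rotation at x.  Exactly one copy of each
   reflection other than x.1 lies strictly between x and its next copy, so the
   default value of the choice is irrelevant. *)
Definition rotate_letter (gT : finGroupType) (m : nat) (Rc : seq gT)
    (x y : colored gT m) : colored gT m :=
  if y == x then next_color x
  else if strictly_between Rc x y then
    odflt y [pick z | strictly_between Rc x z & z.1 == x.1 * y.1 * x.1]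
  else y.

(* G is the increasing rotation of F at the rotated reflection x; these pairs
   (F, G) are the covers of the m-Cambrian lattice. *)
Definition increasing_rotation (gT : finGroupType) (W : {group gT})
    (S : {set gT}) (c Rc : seq gT) (m : nat)
    (F : {set colored gT m}) (x : colored gT m) (G : {set colored gT m}) :
    Prop :=
  [/\ m_factorization W S c Rc F, m_factorization W S c Rc G,
      x \in F, x.2 < m & G = [set rotate_letter Rc x y | y in F]].

(* F :: Gs is a saturated chain, whose successive rotated reflections are xs. *)
Fixpoint rotation_chain (gT : finGroupType) (W : {group gT}) (S : {set gT})
    (c Rc : seq gT) (m : nat) (F : {set colored gT m})
    (xs : seq (colored gT m)) (Gs : seq {set colored gT m}) : Prop :=
  match xs, Gs with
  | [::], [::] => True
  | x :: xs', G :: Gs' =>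
      increasing_rotation W S c Rc F x G /\ rotation_chain W S c Rc G xs' Gs'
  | _, _ => False
  end.

Definition increasing_chain (gT : finGroupType) (W : {group gT}) (S : {set gT})
    (c Rc : seq gT) (m : nat) (F F' : {set colored gT m})
    (Gs : seq {set colored gT m}) : Prop :=
  last F Gs = F' /\
  exists2 xs, rotation_chain W S c Rc F xs Gs & sorted (colored_lt Rc) xs.

(* Main.v *)
(** In an increasing chain, rotations at letters larger than [x] neither create
    nor destroy [x], whereas the rotation at [x] destroys [x].  Hence the first
    rotated letter is the smallest letter of [F] that is missing from [F'], so
    it is determined by [F] and [F'], and one concludes by induction. *)
Require Import Defs.
From mathcomp Require Import all_boot all_order all_fingroup.

Set Implicit Arguments.
Unset Strict Implicit.
Unset Printing Implicit Defensive.

(** With the colors as [s] and [Rc] as [t], this turns comparisons in [colored_word] into arithmetic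
    on colors and positions in [Rc]. *)
Lemma index_allpairs_pair (T I : eqType) (s : seq I) (t : seq T) i r :
    i \in s -> r \in t ->
  index (r, i) [seq (r', i') | i' <- s, r' <- t]
    = index i s * size t + index r t.
Proof.
move=> + r_in; elim: s => //= j s IHs; rewrite inE index_cat.
have inj_pair (k : I) : injective (fun r' : T => (r', k)) by move=> ? ? [].
have [<- _ | ne_ij /= i_in] := eqVneq i j.
  by rewrite map_f // (index_map (inj_pair i)).
rewrite size_map IHs // mulSn addnA ifN //.
by apply/mapP => -[r' _ [_ eq_ij]]; rewrite eq_ij eqxx in ne_ij.
Qed.

Lemma colored_lt_trans (gT : finGroupType) (m : nat) (Rc : seq gT) :
  transitive (@colored_lt gT m Rc).
Proof. by move=> y x z; apply: ltn_trans. Qed.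

Lemma colored_lt_irr (gT : finGroupType) (m : nat) (Rc : seq gT) :
  irreflexive (@colored_lt gT m Rc).
Proof. by move=> x; apply: ltnn. Qed.

(** Membership matters: [index] sends all absent letters to the same value, the length of the
    word. *)
Lemma colored_lt_total (gT : finGroupType) (m : nat) (Rc : seq gT)
    (x y : colored gT m) :
    x \in colored_word m Rc -> y \in colored_word m Rc ->
  ~~ colored_lt Rc x y -> ~~ colored_lt Rc y x -> x = y.
Proof.
rewrite /colored_lt -!leqNgt => x_in y_in le_yx le_xy.
by apply: (index_inj x x_in y_in); apply: anti_leq; rewrite le_xy le_yx.
Qed.

Lemma colored_lt_next_color (gT : finGroupType) (m : nat) (Rc : seq gT)
    (x : colored gT m) :
  x \in colored_word m Rc -> x.2 < m -> colored_lt Rc x (next_color x).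
Proof.
case: x => r i /allpairsP[[j r'] /= [_ r_in [-> _]]] lt_im.
rewrite /colored_lt /colored_word /= !index_allpairs_pair ?mem_enum //.
(* The bound [lt_im] keeps [inord] off its default value. The two positions differ by [size Rc],
   which is positive because [r] occurs in [Rc]. *)
rewrite !index_enum_ord inordK ?ltnS // mulSn -addnA -[ltnLHS]add0n ltn_add2r.
by case: (Rc) r_in.
Qed.

Lemma rotated_letter_removed (gT : finGroupType) (W : {group gT})
    (S : {set gT}) (c Rc : seq gT) (m : nat) (F G : {set colored gT m})
    (x : colored gT m) :
  increasing_rotation W S c Rc F x G -> x \notin G.
Proof.
case=> -[sF _] _ xF lt_xm ->.
have lt_next : colored_lt Rc x (next_color x).
  by apply: colored_lt_next_color => //; apply: sF.
apply/imsetP => -[y _]; rewrite /rotate_letter.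
case: eqVneq => [_ eq_x | ne_yx].
  by rewrite -eq_x colored_lt_irr in lt_next.
case: ifP => _ eq_x; last by rewrite eq_x eqxx in ne_yx.
(* Both outcomes of the choice differ from [x]: a chosen [z] lies strictly after [x], and the
   default value is [y] itself. *)
move: eq_x; case: pickP => [z /andP[/andP[lt_xz _] _] /= eq_x | _ /= eq_x].
  by rewrite -eq_x colored_lt_irr in lt_xz.
by rewrite eq_x eqxx in ne_yx.
Qed.

(** The rotation at [y] moves only [y] and letters after it, and their images again lie after
    [y]. *)
Lemma smaller_letter_kept (gT : finGroupType) (W : {group gT})
    (S : {set gT}) (c Rc : seq gT) (m : nat) (F G : {set colored gT m})
    (x y : colored gT m) :
  increasing_rotation W S c Rc F y G -> colored_lt Rc x y ->
  (x \in G) = (x \in F).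
Proof.
case=> -[sF _] _ yF lt_ym -> lt_xy.
have lt_next : colored_lt Rc y (next_color y).
  by apply: colored_lt_next_color => //; apply: sF.
have nlt_yx : ~~ colored_lt Rc y x by rewrite /colored_lt -leqNgt ltnW.
apply/imsetP/idP => [[z zF] | xF]; last first.
  exists x => //; rewrite /rotate_letter /strictly_between (negPf nlt_yx).
  by case: eqVneq => // eq_xy; rewrite eq_xy colored_lt_irr in lt_xy.
rewrite /rotate_letter; case: eqVneq => [_ eq_x | _].
  by rewrite eq_x lt_next in nlt_yx.
case: ifP => [/andP[lt_yz _] | _ -> //].
case: pickP => [u /andP[/andP[lt_yu _] _] /= eq_x | _ /= -> //].
by rewrite eq_x lt_yu in nlt_yx.
Qed.

Lemma smaller_letter_kept_chain (gT : finGroupType) (W : {group gT})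
    (S : {set gT}) (c Rc : seq gT) (m : nat) (x : colored gT m)
    (xs : seq (colored gT m)) (F : {set colored gT m})
    (Gs : seq {set colored gT m}) :
  rotation_chain W S c Rc F xs Gs -> path (colored_lt Rc) x xs ->
  (x \in last F Gs) = (x \in F).
Proof.
(* By transitivity [x] is below every rotated letter. Unlike the path condition, this bound passes
   to the tail with the same [x], as the induction requires. *)
rewrite (path_sortedE (@colored_lt_trans _ _ _)) => + /andP[+ _].
elim: xs F Gs => [|y xs IHxs] F [|G Gs] //= [rot_y chain] /andP[lt_xy lt_xs].
by rewrite (IHxs G) // (smaller_letter_kept rot_y).
Qed.

Lemma first_rotated_letter_lost (gT : finGroupType) (W : {group gT})
    (S : {set gT}) (c Rc : seq gT) (m : nat) (F G : {set colored gT m})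
    (x : colored gT m) (xs : seq (colored gT m))
    (Gs : seq {set colored gT m}) :
  rotation_chain W S c Rc F (x :: xs) (G :: Gs) ->
  path (colored_lt Rc) x xs -> x \in F /\ x \notin last G Gs.
Proof.
case=> rot_x chain lt_xs; split; first by case: rot_x.
rewrite (smaller_letter_kept_chain chain lt_xs).
exact: rotated_letter_removed rot_x.
Qed.

(** If [x] came before [x'], the second chain would rotate only at letters above [x] and so keep it,
    while the first chain loses it. *)
Lemma first_rotated_letter_nlt (gT : finGroupType) (W : {group gT})
    (S : {set gT}) (c Rc : seq gT) (m : nat) (F G G' : {set colored gT m})
    (x x' : colored gT m) (xs xs' : seq (colored gT m))
    (Gs Gs' : seq {set colored gT m}) :
  rotation_chain W S c Rc F (x :: xs) (G :: Gs) ->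
  path (colored_lt Rc) x xs ->
  rotation_chain W S c Rc F (x' :: xs') (G' :: Gs') ->
  path (colored_lt Rc) x' xs' ->
  last G Gs = last G' Gs' -> ~~ colored_lt Rc x x'.
Proof.
move=> chain lt_xs chain' lt_xs' eq_last; apply/negP => lt_xx'.
have [xF /negP[]] := first_rotated_letter_lost chain lt_xs.
have lt_x_xs' : path (colored_lt Rc) x (x' :: xs') by rewrite /= lt_xx'.
have := smaller_letter_kept_chain chain' lt_x_xs'.
by rewrite eq_last /= => ->.
Qed.

Theorem corollary4p4 (gT : finGroupType) (W : {group gT}) (S : {set gT})
    (c Rc : seq gT) (m : nat)
    (hW : coxeter_system W S) (hc : coxeter_word S c)
    (hRc : reflection_word W S c Rc) (hm : (1 <= m)%N)
    (F F' : {set colored gT m})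
    (hF : m_factorization W S c Rc F) (hF' : m_factorization W S c Rc F')
    (Gs Gs' : seq {set colored gT m})
    (hGs : increasing_chain W S c Rc F F' Gs)
    (hGs' : increasing_chain W S c Rc F F' Gs') :
  Gs = Gs'.
Proof.
case: hGs => {hF hF'} + [xs + +]; case: hGs' => + [xs' + +].
elim: Gs F xs Gs' xs' => [|G Gs IHGs] F [|x xs] [|G' Gs'] [|x' xs'] //=.
(* An empty chain forces [F = F'], but a nonempty one loses a letter of [F]. *)
- move=> eq_F' chain' lt_xs' eq_F _ _.
  have [] := first_rotated_letter_lost chain' lt_xs'.
  by rewrite eq_F' eq_F => ->.
- move=> eq_F _ _ eq_F' chain lt_xs.
  have [] := first_rotated_letter_lost chain lt_xs.
  by rewrite eq_F' eq_F => ->.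
move=> last' chain' lt_xs' last0 chain lt_xs.
have eq_last : last G Gs = last G' Gs' by rewrite last0 last'.
(* The comparison is symmetric in the two chains, so neither first letter precedes the other. *)
have nlt := first_rotated_letter_nlt
  chain lt_xs chain' lt_xs' eq_last.
have nlt' := first_rotated_letter_nlt
  chain' lt_xs' chain lt_xs (esym eq_last).
case: chain chain' => -[fF fG xF lt_xm defG] chain.
case=> -[_ _ x'F _ defG'] chain'.
have eq_x : x = x'.
  by apply: colored_lt_total nlt nlt'; apply: fF.1.
(* A rotation is determined by [F] and the rotated letter, so both chains have the same first
   step. *)
rewrite {}eq_x in defG lt_xs; rewrite -{}defG in defG'; subst G'.
congr (_ :: _); move/path_sorted: lt_xs; move/path_sorted: lt_xs'.
by move=> srt' srt; apply: (IHGs G xs Gs' xs').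
Qed.
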